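(* Let $(\mathcal{R},\leq,r)$ be a deep \textbf{wA2}-space such that $\mathcal{AR}$ is countable. Suppose that there exists a $\Sigma^1_2$-good well-ordering of the reals. Then there exists a $\mathbf{\Sigma}^1_2$ subset of $\mathcal{R}$ which is not Kastanas Ramsey.
   Context: $\mathcal{R}$ nonempty, $\le$ quasi-order on $\mathcal{R}$, $r:\mathcal{R}\times\omega\to\mathcal{AR}$, $r_n(A):=r(A,n)$, $\mathcal{AR}_n$ the image of $r_n$. A1: (1) $r_0(A)=\emptyset$; (2) $A\ne B\Rightarrow r_n(A)\ne r_n(B)$ for some $n$; (3) $r_n(A)=r_m(B)\Rightarrow n=m$ and $r_k(A)=r_k(B)$ for $k<n$. $\mathrm{lh}(a)$: the $n$ with $a\in\mathcal{AR}_n$; $a\sqsubseteq b$ iff $a=r_m(A)$, $b=r_n(A)$ for some $A$, $m\le n$. wA2: a quasi-order $\leq_{\mathrm{fin}}$ on $\mathcal{AR}$ with (w1) $\{a:a\leq_{\mathrm{fin}}b\}$ countable; (2) $A\le B$ iff $\forall n\exists m\ r_n(A)\leq_{\mathrm{fin}}r_m(B)$; (3) $a\sqsubseteq b\leq_{\mathrm{fin}}c\Rightarrow\exists d\sqsubseteq c\ a\leq_{\mathrm{fin}}d$. $[a,A]=\{B\le A:\exists n\ r_n(B)=a\}$; $[n,A]=[r_n(A),A]$; $\mathrm{depth}_B(a)=\min\{n:a\leq_{\mathrm{fin}}r_n(B)\}$ or $\infty$; $\mathcal{AR}{\upharpoonright}A=\{a:\exists n\ a\leq_{\mathrm{fin}}r_n(A)\}$;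 $r_n[a,A]=\{b\in\mathcal{AR}{\upharpoonright}A:a\sqsubseteq b,\mathrm{lh}(b)=n\}$. A3: (1) $\mathrm{depth}_B(a)<\infty\Rightarrow[a,A]\ne\emptyset$ for all $A\in[\mathrm{depth}_B(a),B]$; (2) $A\le B$, $[a,A]\ne\emptyset\Rightarrow\exists A'\in[\mathrm{depth}_B(a),B]$ with $\emptyset\ne[a,A']\subseteq[a,A]$. A \textbf{wA2}-space: A1, wA2, A3 hold and $\mathcal{R}$ (identified with $\{(r_n(A))_n\}$) is closed in $\mathcal{AR}^{\mathbb N}$, topologised by the first-difference metric (Polish when $\mathcal{AR}$ is countable). Deep: for all $A\in\mathcal{R}$, $a\in\mathcal{AR}{\upharpoonright}A$ and $N<\omega$ there is $B\in[a,A]$ such that $\mathrm{depth}_A(b)\ge N$ for all $b\in r_{\mathrm{lh}(a)+1}[a,B]$. Kastanas game $K[a,A]$: with $a_0=a$, $B_{-1}=A$, in round $n\ge0$ I plays $A_n\in[a_n,B_{n-1}]$, then II plays $a_{n+1}\in r_{\mathrm{lh}(a_n)+1}[a_n,A_n]$ and $B_n\in[a_{n+1},A_n]$; outcome: the $B$ with $r_{\mathrm{lh}(a)+n}(B)=a_n$ for all $n$. $\mathcal{X}$ is Kastanas Ramsey if for all $A$ and $a\in\mathcal{AR}{\upharpoonright}A$ there is $B\in[a,A]$ such that I has a strategy in $K[a,B]$ ensuring the outcome lies in $\mathcal{X}^c$, or II has a strategy in $K[a,B]$ ensuring the outcome lies in $\mathcal{X}$. *)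

(* Defs.v *)
From HB Require Import structures.
From mathcomp Require Import all_boot all_classical.
From mathcomp Require Import wochoice topology.

Set Implicit Arguments.
Unset Strict Implicit.
Unset Printing Implicit Defensive.

Local Open Scope classical_set_scope.

(* [AR] is a type all of whose elements are approximations (see [AR_image]
   below), and [r A n] is the n-th approximation of [A].  Classically every
   type is a [choiceType], so this assumption, needed to topologise [R] and
   [AR], costs no generality. *)
Section Spaces.
Variables (R AR : choiceType).
Variables (le : R -> R -> Prop) (r : R -> nat -> AR) (lefin : AR -> AR -> Prop).

Definition quasi_order (T : Type) (e : T -> T -> Prop) : Prop :=
  (forall x, e x x) /\ (forall x y z, e x y -> e y z -> e x z).

(* Under A1(3) at most one [n] qualifies. *)
Definition lh (a : AR) : nat := xget 0 [set n | exists A, r A n = a].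

Definition initial (a b : AR) : Prop :=
  exists A m n, [/\ m <= n, a = r A m & b = r A n].

(* The set written [a, A]. *)
Definition basic (a : AR) (A : R) : set R :=
  [set B | le B A /\ exists n, r B n = a].

(* [None] stands for the value "infinity". *)
Definition depth (B : R) (a : AR) : option nat :=
  match pselect (exists n, `[< lefin a (r B n) >]) with
  | left h => Some (ex_minn h)
  | right _ => None
  end.

(* [d, B] = [r_d(B), B] for a depth d; only ever used for finite d. *)
Definition basic_at (d : option nat) (B : R) : set R :=
  if d is Some n then basic (r B n) B else set0.

Definition depth_ge (d : option nat) (N : nat) : Prop :=
  if d is Some n then N <= n else True.

(* AR restricted to A. *)
Definition approx_below (A : R) : set AR := [set a | exists n, lefin a (r A n)].

(* The set written r_n[a, A]. *)
Definition layer (n : nat) (a : AR) (A : R) : set AR :=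
  [set b | [/\ approx_below A b, initial a b & lh b = n]].

(* In A1(1), the empty sequence is just a name for the common value of the
   0-th approximations. *)
Record A1 : Prop := {
  A1_1 : forall A B, r A 0 = r B 0;
  A1_2 : forall A B, A <> B -> exists n, r A n <> r B n;
  A1_3 : forall A B n m, r A n = r B m ->
           n = m /\ forall k, k < n -> r A k = r B k
}.

Record wA2 : Prop := {
  wA2_quasi_order : quasi_order lefin;
  wA2_1 : forall b, countable [set a | lefin a b];
  wA2_2 : forall A B, le A B <-> forall n, exists m, lefin (r A n) (r B m);
  wA2_3 : forall a b c, initial a b -> lefin b c ->
            exists d, initial d c /\ lefin a d
}.

Record A3 : Prop := {
  A3_1 : forall a B, depth B a <> None ->
           forall A, basic_at (depth B a) B A -> basic a A !=set0;
  A3_2 : forall a A B, le A B -> basic a A !=set0 ->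
           exists A', [/\ basic_at (depth B a) B A',
                          basic a A' !=set0 & basic a A' `<=` basic a A]
}.

(* The topology of the first-difference metric on sequences of approximations
   is the product of the discrete topologies. *)
Definition approx_seq (A : R) : {ptws nat -> discrete_topology AR} := r A.

Record wA2_space : Prop := {
  R_nonempty : [set: R] !=set0;
  R_quasi_order : quasi_order le;
  AR_image : forall a, exists A n, r A n = a;
  space_A1 : A1;
  space_wA2 : wA2;
  space_A3 : A3;
  R_closed : closed (range approx_seq)
}.

Definition space_topology : topologicalType := initial_topology approx_seq.

Definition deep : Prop :=
  forall A a N, approx_below A a ->
    exists2 B, basic a A B &
      forall b, layer (lh a).+1 a B b -> depth_ge (depth A b) N.

(* A run of the game K[a, A] is recorded by the sequence [x] of the moves
   A_0, A_1, ... of player I and the sequence [s] of the pairs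
   s n = (a_n, B_{n-1}).  So s 0 = (a, A), and s n.+1 is the move of II in
   round n. *)
Section Game.
Variables (x : nat -> R) (s : nat -> AR * R).

Definition legalI (n : nat) : Prop := basic (s n).1 (s n).2 (x n).

Definition legalII (n : nat) : Prop :=
  layer (lh (s n).1).+1 (s n).1 (x n) (s n.+1).1 /\
  basic (s n.+1).1 (x n) (s n.+1).2.

Definition outcome (B : R) : Prop :=
  forall n, r B (lh (s 0).1 + n) = (s n).1.

End Game.

(* A strategy is a function of the moves made so far by the opponent.  It must
   make legal moves as long as the opponent does.  In a [wA2_space], a run with
   only legal moves has exactly one outcome. *)
Definition I_ensures (a : AR) (A : R) (Y : set R) : Prop :=
  exists sigma : seq (AR * R) -> R, forall x s,
    s 0 = (a, A) ->
    (forall n, x n = sigma (mkseq (fun k => s k.+1) n)) ->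
    (forall n, (forall k, k < n -> legalII x s k) -> legalI x s n) /\
    ((forall n, legalII x s n) -> forall B, outcome s B -> Y B).

Definition II_ensures (a : AR) (A : R) (Y : set R) : Prop :=
  exists tau : seq R -> AR * R, forall x s,
    s 0 = (a, A) ->
    (forall n, s n.+1 = tau (mkseq x n.+1)) ->
    (forall n, (forall k, k <= n -> legalI x s k) -> legalII x s n) /\
    ((forall n, legalI x s n) -> forall B, outcome s B -> Y B).

Definition kastanas_ramsey (X : set R) : Prop :=
  forall A a, approx_below A a ->
    exists2 B, basic a A B & I_ensures a B (~` X) \/ II_ensures a B X.

End Spaces.

(* Boldface projective classes.  They are meant for zero-dimensional Polish
   spaces, where the analytic sets are the projections of closed sets. *)
Section Boldface.
Variable T : topologicalType.

Definition bold_Sigma11 (X : set T) : Prop :=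
  exists2 F : set (T * {ptws nat -> nat}),
    closed F & X = [set x | exists y, F (x, y)].

Definition bold_Pi11 (X : set T) : Prop := bold_Sigma11 (~` X).

End Boldface.

Definition bold_Sigma12 (T : topologicalType) (X : set T) : Prop :=
  exists2 P : set (T * {ptws nat -> nat}),
    bold_Pi11 P & X = [set x | exists y, P (x, y)].

(* Arithmetical formulas, with de Bruijn indices for the number variables.
   [App k t] is the value at [t] of the k-th function variable; function
   variables are not quantified. *)
Inductive aterm : Type :=
  | Var of nat
  | Zero
  | Succ of aterm
  | Add of aterm & aterm
  | Mul of aterm & aterm
  | App of nat & aterm.

Inductive aform : Type :=
  | Eq of aterm & aterm
  | Neg of aform
  | And of aform & aform
  | All of aform.

Fixpoint aval (f : seq (nat -> nat)) (e : seq nat) (t : aterm) : nat :=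
  match t with
  | Var i => nth 0 e i
  | Zero => 0
  | Succ t => (aval f e t).+1
  | Add t u => aval f e t + aval f e u
  | Mul t u => aval f e t * aval f e u
  | App k t => nth (fun=> 0) f k (aval f e t)
  end.

Fixpoint asat (f : seq (nat -> nat)) (e : seq nat) (p : aform) : Prop :=
  match p with
  | Eq t u => aval f e t = aval f e u
  | Neg p => ~ asat f e p
  | And p q => asat f e p /\ asat f e q
  | All p => forall n, asat f (n :: e) p
  end.

(* Lightface: no real parameters. *)
Definition Sigma12 (P : (nat -> nat) -> (nat -> nat) -> Prop) : Prop :=
  exists p : aform, forall x y,
    P x y <-> exists u, forall v, asat [:: x; y; u; v] [::] p.

Definition cantor_pair (i n : nat) : nat := 'C((i + n).+1, 2) + n.

(* The i-th real (x)_i of the sequence coded by the real x. *)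
Definition unfold_real (x : nat -> nat) (i : nat) : nat -> nat :=
  fun n => x (cantor_pair i n).

(* [w] is the non-strict order.  As there are uncountably many reals,
   [good_countable] says that the order type is omega_1. *)
Record Sigma12_good (w : rel (nat -> nat)) : Prop := {
  good_well_order : well_order w;
  good_countable : forall y, countable [set z | w z y];
  good_Sigma12 : Sigma12 w;
  good_segments : Sigma12 (fun x y => range (unfold_real x) = [set z | w z y])
}.

(* Main.v *)
Require Import Defs.
From mathcomp Require Import all_boot all_classical.
From mathcomp Require Import wochoice topology.

(* From a strategy in K[a, A] one extracts a binary tree of plays against it
   with pairwise different outcomes: deepness provides, at each position, two
   moves of the opponent after which the next approximations differ.  So a set
   X is not Kastanas Ramsey as soon as X and its complement meet the range of
   every map v |-> H(z, v), where z is a real coding such a tree and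
   H(z, v) is its branch given by the real v.

   Such a set is found without recursion.  Call m closed if {y | y < m} is
   closed under H, and let X be the set of the x such that the largest closed
   m <= x satisfies m(n) = k.  This is Sigma^1_2, as a good well-ordering bounds
   all quantifiers over predecessors of x by one real enumerating them.  If m is
   large, and also closed under the inverses of the maps H(z, -), then m is the
   largest closed real below H(z, m), so that H(z, m) is in X iff m(n) = k.  By
   countability of the initial segments, such m form an uncountable set, and n
   and k can be chosen so that both m(n) = k and m(n) <> k hold for uncountably
   many of them. *)

Set Implicit Arguments.
Unset Strict Implicit.
Unset Printing Implicit Defensive.

Local Open Scope classical_set_scope.

(** * Projective pointclasses *)

Notation baire := {ptws nat -> nat}.

(** * Locally constant maps and continuity into Baire space *)

Section LocallyConstant.
Variable T : topologicalType.

(** Continuity into a discrete space, for value types that carry no topology. *)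
Definition locconst (D : Type) (g : T -> D) : Prop :=
  forall x, \forall y \near x, g y = g x.

Lemma locconst_cst (D : Type) (d : D) : locconst (fun=> d).
Proof. by move=> x; apply: nearW. Qed.

Lemma locconst_bind (D E : Type) (g : T -> D) (h : D -> T -> E) :
  locconst g -> (forall d, locconst (h d)) -> locconst (fun x => h (g x) x).
Proof.
move=> cg ch x; have := ch (g x) x; have := cg x.
by apply: filterS2 => y ->.
Qed.

Lemma locconst_comp (D E : Type) (h : D -> E) (g : T -> D) :
  locconst g -> locconst (fun x => h (g x)).
Proof.
by move=> cg; apply: (locconst_bind (h := fun d _ => h d)) => // d; exact: locconst_cst.
Qed.

Lemma locconst_comp2 (D1 D2 E : Type) (h : D1 -> D2 -> E) (g1 : T -> D1) (g2 : T -> D2) :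
  locconst g1 -> locconst g2 -> locconst (fun x => h (g1 x) (g2 x)).
Proof.
move=> c1 c2; apply: (locconst_bind (h := fun d x => h d (g2 x))) => // d.
exact: locconst_comp.
Qed.

Lemma locconst_mkseq (D : Type) (f : T -> nat -> D) n :
  (forall k, locconst (fun x => f x k)) -> locconst (fun x => mkseq (f x) n).
Proof.
move=> cf; elim: n => [|n IHn]; first exact: locconst_cst.
have -> : (fun x => mkseq (f x) n.+1) = (fun x => rcons (mkseq (f x) n) (f x n)).
  by apply/funext => x; rewrite mkseqS.
exact: locconst_comp2.
Qed.

Lemma locconst_continuous (g : T -> nat) : locconst g <-> continuous g.
Proof.
split=> cg x.
  move=> A; rewrite nbhs_principalE => /principal_filterP Agx.
  by apply: filterS (cg x) => y /= ->.
by apply: (cg x [set n | n = g x]); rewrite nbhs_principalE; apply/principal_filterP.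
Qed.

Lemma continuous_ptws (V : topologicalType) (f : T -> {ptws nat -> V}) :
  continuous f <-> forall n, continuous (fun x => f x n).
Proof.
split=> cf; first by
  move=> n x; exact: (continuous_comp (cf x) (@proj_continuous nat (fun=> V) n (f x))).
move=> x; apply/cvg_sup => n.
exact: (@continuous_comp_initial _ T V (fun g : {ptws nat -> V} => g n) f (cf n) x).
Qed.

Lemma continuous_baire (f : T -> baire) :
  continuous f <-> forall n, locconst (fun x => f x n).
Proof.
rewrite continuous_ptws; split=> cf n; have := cf n; first by move/locconst_continuous.
by move/locconst_continuous.
Qed.

Lemma closed_locconst (D : Type) (g : T -> D) (P : set D) :
  locconst g -> closed (g @^-1` P).
Proof.
move=> cg; rewrite -openC openE => x /= nPx.
by apply: filterS (cg x) => y /= ->.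
Qed.

End LocallyConstant.

Lemma locconst_preim (S T : topologicalType) (D : Type) (f : S -> T) (g : T -> D) :
  continuous f -> locconst g -> locconst (g \o f).
Proof. by move=> cf cg x; exact: (cf x _ (cg (f x))). Qed.

Lemma comp_continuous (S T U : topologicalType) (f : S -> T) (g : T -> U) :
  continuous f -> continuous g -> continuous (fun x => g (f x)).
Proof. by move=> cf cg x; exact: (continuous_comp (cf x) (cg (f x))). Qed.

Lemma continuous_pairing (S T U : topologicalType) (f : S -> T) (g : S -> U) :
  continuous f -> continuous g -> continuous (fun x => (f x, g x)).
Proof. by move=> cf cg x; apply: cvg_pair; [exact: cf | exact: cg]. Qed.

Lemma continuous_fst (T U : topologicalType) : continuous (@fst T U).
Proof. by move=> x; exact: cvg_fst. Qed.

Lemma continuous_snd (T U : topologicalType) : continuous (@snd T U).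
Proof. by move=> x; exact: cvg_snd. Qed.

Lemma continuous_reindex (h : nat -> nat) : continuous (fun y : baire => y \o h : baire).
Proof.
apply/continuous_ptws => n.
exact: (@proj_continuous nat (fun=> nat)).
Qed.

Lemma locconst_eval (n : nat) : locconst (fun y : baire => y n).
Proof. apply/locconst_continuous; exact: (@proj_continuous nat (fun=> nat)). Qed.

Definition pointclass := forall T : topologicalType, set T -> Prop.

(* Closed sets are not closed under countable unions; gluing along a clopen
   partition is the part of that property which they do have, it suffices for
   their projections to have the full one, and it is invariant under
   complementation. *)
Record robust (G : pointclass) : Prop := {
  robust_preim : forall (S T : topologicalType) (f : S -> T) (X : set T),
    continuous f -> G T X -> G S (f @^-1` X);
  robust_forall : forall (T : topologicalType) (X : nat -> set T),
    (forall n, G T (X n)) -> G T [set x | forall n, X n x];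
  robust_glue : forall (T : topologicalType) (g : T -> nat) (X : nat -> set T),
    locconst g -> (forall n, G T (X n)) -> G T [set x | X (g x) x]
}.

Definition proj (G : pointclass) : pointclass := fun T X =>
  exists2 F : set (T * baire), G (T * baire)%type F & X = [set x | exists y, F (x, y)].

Definition dual (G : pointclass) : pointclass := fun T X => G T (~` X).

Definition closed_exists (G : pointclass) : Prop :=
  forall (T : topologicalType) (X : nat -> set T),
    (forall n, G T (X n)) -> G T [set x | exists n, X n x].

Lemma robust_closed : robust (@closed).
Proof.
split=> [S T f X cf cX|T X cX|T g X cg cX].
- by apply: preimage_closed => // x _; exact: cf.
- have -> : [set x | forall n, X n x] = \bigcap_n X n.
    by apply/seteqP; split=> x /= Xx n; [move=> _; exact: Xx | exact: Xx].
  exact: closed_bigI.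
- rewrite -openC openE => x /= nXx.
  have: nbhs x (~` X (g x)) by apply: open_nbhs_nbhs; split=> //; exact: closed_openC.
  by have := cg x; apply: filterS2 => y /= <-.
Qed.

Lemma robust_dual (G : pointclass) : robust G -> closed_exists G -> robust (dual G).
Proof.
move=> rG exG; split=> [S T f X|T X GX|T g X cg GX].
- by move=> cf GX; exact: (robust_preim rG cf GX).
- rewrite /dual [X in G _ X](_ : _ = [set x | exists n, (~` X n) x]); first exact: exG.
  by apply/seteqP; split=> x /=; move/existsNP.
- exact: (robust_glue rG cg GX).
Qed.

Section Projection.
Variables (G : pointclass) (rG : robust G).

(** One real codes a sequence of reals; witnesses of several projections are merged in this way. *)
Definition slice (i : nat) (y : baire) : baire := fun n => y (pickle (i, n)).

Lemma slice_onto (f : nat -> nat -> nat) : exists y : baire, forall i, slice i y = f i.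
Proof.
exists (fun k => if unpickle k is Some (i, n) then f i n else 0) => i.
by apply/funext => n; rewrite /slice pickleK.
Qed.

Lemma continuous_slice (i : nat) : continuous (slice i).
Proof. exact (@continuous_reindex (fun n => pickle (i, n))). Qed.

Lemma proj_sub (T : topologicalType) (X : set T) : G X -> proj G X.
Proof.
move=> GX; exists (fst @^-1` X); first by apply: robust_preim => //; exact: continuous_fst.
apply/seteqP; split=> x /=; last by case.
by exists (fun=> 0).
Qed.

Lemma proj_family (T : topologicalType) (X : nat -> set T) :
  (forall n, proj G (X n)) ->
  exists F : nat -> set (T * baire), (forall n, G (F n)) /\
    forall n, X n = [set x | exists y, F n (x, y)].
Proof.
move=> GX; have /choice[F FP] n : exists F : set (T * baire), G F /\
  X n = [set x | exists y, F (x, y)] by have [F] := GX n; exists F.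
by exists F; split=> n; have [] := FP n.
Qed.

(** The entry [y 0] of a witness names the index n, and its tail witnesses membership in [X n].
    Gluing along [y 0] replaces a countable union inside [G]. *)
Lemma proj_exists : closed_exists (proj G).
Proof.
move=> T X /proj_family[F [GF XF]].
pose tl (p : T * baire) : T * baire := (p.1, p.2 \o S).
have ctl : continuous tl.
  apply: continuous_pairing; first exact: continuous_fst.
  exact (comp_continuous (@continuous_snd _ _) (@continuous_reindex S)).
exists [set p | (tl @^-1` F (p.2 0)) p].
  apply: (robust_glue rG (g := fun p : T * baire => p.2 0) (X := fun n => tl @^-1` F n)) => [|n].
    exact: (locconst_preim (@continuous_snd T baire) (@locconst_eval 0)).
  exact: (robust_preim rG ctl).
apply/seteqP; split=> x /= [n].
  rewrite XF => -[y Fy]; exists (fun k => if k is k'.+1 then y k' else n) => //=.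
by move=> Fn; exists (n 0); rewrite XF; eexists; exact: Fn.
Qed.

Lemma robust_proj : robust (proj G).
Proof.
split=> [S T f X cf [F GF ->]|T X /proj_family[F [GF XF]]|
         T g X cg /proj_family[F [GF XF]]].
- exists ((fun p : S * baire => (f p.1, p.2)) @^-1` F) => //.
  apply: robust_preim => //; apply: continuous_pairing; last exact: continuous_snd.
  exact: (comp_continuous (@continuous_fst _ _) cf).
- exists [set p | forall n, F n (p.1, slice n p.2)].
    apply: (robust_forall rG) => n.
    apply: (robust_preim rG (f := fun p => (p.1, slice n p.2))) => //.
    apply: continuous_pairing; first exact: continuous_fst.
    exact: (comp_continuous (@continuous_snd _ _) (@continuous_slice n)).
  apply/seteqP; split=> x /=; last first.
    by case=> y Fy n; rewrite XF; exists (slice n y).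
  move=> Xx; have /choice[f Ff] : forall n, exists y, F n (x, y).
    by move=> n; have := Xx n; rewrite XF.
  by have [y yf] := slice_onto f; exists y => n; rewrite yf.
- exists [set p | F (g p.1) p].
    apply: (robust_glue rG (g := g \o fst) (X := F)) => //.
    by apply: locconst_preim => //; exact: continuous_fst.
  by apply/seteqP; split=> x /=; rewrite XF.
Qed.

Lemma proj_proj (T : topologicalType) (X : set (T * baire)) :
  proj G X -> proj G [set x | exists y, X (x, y)].
Proof.
case=> F GF ->; exists [set p | F ((p.1, slice 0 p.2), slice 1 p.2)].
  apply: (robust_preim rG (f := fun p => ((p.1, slice 0 p.2), slice 1 p.2))) => //.
  have cs i : continuous (fun p : T * baire => slice i p.2).
    exact: (comp_continuous (@continuous_snd _ _) (@continuous_slice i)).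
  by do !apply: continuous_pairing => //; exact: continuous_fst.
apply/seteqP; split=> x /=; last by case=> y Fy; exists (slice 0 y), (slice 1 y).
case=> y [u Fyu].
have [s sE] := slice_onto (fun i => if i is 0 then y else u).
by exists s; rewrite !sE.
Qed.

End Projection.

Lemma robust_Sigma11 : robust (@bold_Sigma11).
Proof. exact: robust_proj robust_closed. Qed.

Lemma robust_Pi11 : robust (@bold_Pi11).
Proof. exact: robust_dual robust_Sigma11 (proj_exists robust_closed). Qed.

Lemma robust_Sigma12 : robust (@bold_Sigma12).
Proof. exact: robust_proj robust_Pi11. Qed.

Lemma bold_Sigma12_existsn : closed_exists (@bold_Sigma12).
Proof. exact: proj_exists robust_Pi11. Qed.

Lemma bold_Sigma12_exists (T : topologicalType) (X : set (T * baire)) :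
  bold_Sigma12 X -> bold_Sigma12 [set x | exists y, X (x, y)].
Proof. exact: (proj_proj robust_Pi11). Qed.

Lemma bold_Sigma12_locconst (T : topologicalType) (D : Type) (g : T -> D) (P : set D) :
  locconst g -> bold_Sigma12 [set x | P (g x)].
Proof.
move=> cg; apply: (proj_sub robust_Pi11); apply: (proj_sub robust_closed).
exact (closed_locconst (P := ~` P) cg).
Qed.

Lemma bold_Sigma12_or (T : topologicalType) (X Y : set T) :
  bold_Sigma12 X -> bold_Sigma12 Y -> bold_Sigma12 [set x | X x \/ Y x].
Proof.
move=> SX SY; rewrite [X in bold_Sigma12 X](_ : _ =
    [set x | exists n, (if n is 0 then X else Y) x]).
  by apply: (bold_Sigma12_existsn (X := fun n => if n is 0 then X else Y)) => -[].
apply/seteqP; split=> x /=; first by case; [exists 0 | exists 1].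
by case=> -[|n]; [left | right].
Qed.

Lemma bold_Sigma12_and (T : topologicalType) (X Y : set T) :
  bold_Sigma12 X -> bold_Sigma12 Y -> bold_Sigma12 [set x | X x /\ Y x].
Proof.
move=> SX SY; rewrite [X in bold_Sigma12 X](_ : _ =
    [set x | forall n, (if n is 0 then X else Y) x]).
  by apply: (robust_forall robust_Sigma12 (X := fun n => if n is 0 then X else Y)) => -[].
by apply/seteqP; split=> x /=; [case=> ? ? [] | move=> XY; split; [exact: (XY 0) | exact: (XY 1)]].
Qed.

(** * From arithmetical formulas to boldface classes *)

Section Arithmetical.
Variables (T : topologicalType) (f : T -> seq (nat -> nat)).
Hypothesis cf : forall k n, locconst (fun x => nth (fun=> 0) (f x) k n).

Lemma locconst_aval (e : seq nat) (t : aterm) : locconst (fun x => aval (f x) e t).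
Proof.
elim: t => /= [i||t IHt|t IHt u IHu|t IHt u IHu|k t IHt].
- exact: locconst_cst.
- exact: locconst_cst.
- exact: locconst_comp.
- exact: locconst_comp2.
- exact: locconst_comp2.
- exact: (locconst_bind (h := fun n x => nth (fun=> 0) (f x) k n)).
Qed.

(** Values of terms are locally constant, so equations are clopen. Both classes are carried through
    the induction because negation exchanges them. *)
Lemma bold_Delta11_asat (p : aform) (e : seq nat) :
  bold_Sigma11 [set x | asat (f x) e p] /\ bold_Pi11 [set x | asat (f x) e p].
Proof.
elim: p e => [t u|p IHp|p IHp q IHq|p IHp] e /=.
- have c : locconst (fun x => (aval (f x) e t, aval (f x) e u)).
    by apply: locconst_comp2; exact: locconst_aval.
  by split; apply: (proj_sub robust_closed);
    [exact (closed_locconst (P := [set d | d.1 = d.2]) c) |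
     exact (closed_locconst (P := [set d | d.1 <> d.2]) c)].
- have [Sp Pp] := IHp e; split=> //; rewrite /bold_Pi11 [X in bold_Sigma11 X](_ : _ =
    [set x | asat (f x) e p]) //.
  by apply/seteqP; split=> x /=; [move/contrapT | move=> ? []].
- have [Sp Pp] := IHp e; have [Sq Pq] := IHq e.
  have -> : [set x | asat (f x) e p /\ asat (f x) e q] =
      [set x | forall n, asat (f x) e (if n is 0 then p else q)].
    by apply/seteqP; split=> x /=; [case=> ? ? [] | move=> A; split; [exact: (A 0) | exact: (A 1)]].
  by split; [apply: (robust_forall robust_Sigma11) | apply: (robust_forall robust_Pi11)] => -[].
- by split; [apply: (robust_forall robust_Sigma11) | apply: (robust_forall robust_Pi11)] => n;
    have [] := IHp (n :: e).
Qed.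

End Arithmetical.

Lemma bold_Sigma12_Sigma12 (P : (nat -> nat) -> (nat -> nat) -> Prop)
    (T : topologicalType) (f g : T -> baire) :
  Sigma12 P -> continuous f -> continuous g -> bold_Sigma12 [set x | P (f x) (g x)].
Proof.
case=> p Pp cf cg.
pose F (q : T * baire * baire) : seq (nat -> nat) := [:: f q.1.1; g q.1.1; q.1.2; q.2].
have cF k n : locconst (fun q => nth (fun=> 0) (F q) k n).
  have cpr (U V : topologicalType) (h : U -> baire) : continuous h ->
      locconst (fun q : U * V => h q.1 n).
    move=> /continuous_baire ch.
    by apply: (locconst_preim (@continuous_fst U V) (ch n)).
  case: k => [|[|[|[|k]]]] /=.
  - exact: (cpr _ _ _ (comp_continuous (@continuous_fst T baire) cf)).
  - exact: (cpr _ _ _ (comp_continuous (@continuous_fst T baire) cg)).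
  - exact: (cpr _ _ snd (@continuous_snd _ _)).
  - exact: (locconst_preim (@continuous_snd (T * baire)%type baire) (@locconst_eval n)).
  - by rewrite nth_nil; exact: locconst_cst.
have [_ PiF] := bold_Delta11_asat cF p [::].
exists [set q | forall v, asat (F (q, v)) [::] p].
  (* The complement is the projection of a Sigma^1_1 set. *)
  rewrite /bold_Pi11 [X in bold_Sigma11 X](_ : _ =
    [set q | exists v, (~` [set r | asat (F r) [::] p]) (q, v)]).
    exact: (proj_proj robust_closed PiF).
  by apply/seteqP; split=> q /= /existsNP.
by apply/seteqP; split=> x; have [Pl Pr] := Pp (f x) (g x); [exact: Pl | exact: Pr].
Qed.

(** * Well-orders of type omega_1 *)

Lemma countable_subset (T : Type) (A B : set T) : A `<=` B -> countable B -> countable A.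
Proof. by move=> AB; apply: sub_countable; exact: subset_card_le. Qed.

Lemma countable_range (T : choiceType) (A : set T) (x0 : T) :
  countable A -> A x0 -> exists g : nat -> T, range g = A.
Proof.
move=> /countable_injP[f injf] Ax0.
exists (fun n => xget x0 [set y | A y /\ f y = n]).
apply/seteqP; split=> [_ [n _ <-]|y Ay]; first by case: xgetP => // y _ [].
exists (f y) => //; case: xgetP => [z _ [Az /injf]|/(_ y)[]//].
by apply; apply/mem_set.
Qed.

Lemma baire_uncountable : ~ countable [set: nat -> nat].
Proof.
move=> /countable_injP[f injf].
(* Cantor's diagonal: [d] differs at n from the real numbered n, taken to be zero if there is
   none. *)
pose d n := (xget (fun=> 0) [set y | f y = n] n).+1.
have gd : xget (fun=> 0) [set y | f y = f d] = d.
  by case: xgetP => [y _ /injf|/(_ d)[]//]; apply; exact/mem_set.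
by have /n_Sn : d (f d) = (d (f d)).+1 by rewrite -{3}gd.
Qed.

Section WellOrder.
Variables (T : Type) (w : rel T).
Hypotheses (w_wo : well_order w) (w_countable : forall y, countable [set z | w z y])
  (T_uncountable : ~ countable [set: T]).

Let lt x y := ~ w y x.

Lemma wo_min (A : set T) : A !=set0 -> exists2 z, A z & forall x, A x -> w z x.
Proof.
move=> [x Ax]; have [|z [[/asboolP Az minz] _]] := w_wo (A := fun y => `[< A y >]).
  by exists x; apply/asboolP.
by exists z => // y Ay; apply: minz; apply/asboolP.
Qed.

Lemma wo_total x y : w x y \/ w y x.
Proof.
have [|z zxy minz] := @wo_min [set x; y]; first by exists x; left.
by case: zxy minz => -> minz; [left|right]; apply: minz; [right|left].
Qed.

Lemma wo_refl x : w x x.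
Proof. by case: (wo_total x x). Qed.

(** Both x and y are least in {x, y}, and [well_order] makes least elements unique. *)
Lemma wo_anti x y : w x y -> w y x -> x = y.
Proof.
move=> wxy wyx; pose A z := `[< z = x \/ z = y >].
have [|z [_ uz]] := w_wo (A := A); first by exists x; apply/asboolP; left.
rewrite -(uz x) ?(uz y) //; split; try (by apply/asboolP; (left + right));
  by move=> t /asboolP[->|->] //; exact: wo_refl.
Qed.

Lemma wo_trans y x z : w x y -> w y z -> w x z.
Proof.
move=> wxy wyz; have [|t txyz mint] := @wo_min [set t | [\/ t = x, t = y | t = z]].
  by exists x; constructor.
have [tx ty tz] : [/\ w t x, w t y & w t z].
  by split; apply: mint; [constructor 1 | constructor 2 | constructor 3].
case: txyz => tE; rewrite tE in tx ty tz => //.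
- by rewrite (wo_anti wxy tx).
- by rewrite -(wo_anti wyz ty).
Qed.

Lemma wo_lt x y : lt x y <-> w x y /\ x <> y.
Proof.
split=> [nyx|[wxy nxy] wyx]; last exact/nxy/wo_anti.
split; first by case: (wo_total x y).
by move=> xy; apply: nyx; rewrite xy; exact: wo_refl.
Qed.

Lemma wo_ltW x y : lt x y -> w x y.
Proof. by case/wo_lt. Qed.

Lemma wo_lt_le y x z : lt x y -> w y z -> lt x z.
Proof. by move=> xy yz zx; apply: xy; exact: wo_trans zx. Qed.

Lemma wo_le_lt y x z : w x y -> lt y z -> lt x z.
Proof. by move=> xy yz zx; apply: yz; exact: wo_trans xy. Qed.

(** Otherwise the countable segments below the elements of [S] would cover [T]. *)
Lemma wo_countable_bounded (S : set T) : countable S -> exists u, forall s, S s -> lt s u.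
Proof.
move=> cS; apply: contrapT => nb; apply: T_uncountable.
apply: (@countable_subset _ _ (\bigcup_(s in S) [set z | w z s])) => [u _|].
  apply: contrapT => nu; apply: nb; exists u => s Ss wus.
  by apply: nu; exists s.
exact: bigcup_countable.
Qed.

Lemma wo_uncountable_above (M : set T) z : ~ countable M -> exists2 m, M m & lt z m.
Proof.
move=> ncM; apply: contrapT => nm; apply: ncM; apply: countable_subset (w_countable z) => m Mm /=.
by apply: contrapT => nmz; apply: nm; exists m.
Qed.

Definition wo_closed (I : Type) (F : I -> T -> T -> T) (m : T) : Prop :=
  forall i p q, lt p m -> lt q m -> lt (F i p q) m.

(* The least strict upper bound of a sequence in which each term bounds the
   values of [F] below the previous one. *)
Lemma wo_closed_unbounded (F : nat -> T -> T -> T) z :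
  exists2 m, wo_closed F m & lt z m.
Proof.
(* The projection is added so that [b u] also exceeds u itself; hence the sequence [c] increases. *)
pose F' n := if n is n'.+1 then F n' else fun p _ => p.
have /choice[b bP] u : exists u', forall i p q, w p u -> w q u -> lt (F' i p q) u'.
  pose S := [set F' t.1 t.2.1 t.2.2 | t in
    [set: nat] `*` ([set p | w p u] `*` [set q | w q u])].
  have [|u' u'P] := @wo_countable_bounded S.
    apply: sub_countable (card_image_le _ _) _.
    by apply: countableX => //; exact: countableX.
  by exists u' => i p q pu qu; apply: u'P; exists (i, (p, q)).
pose c n := iter n b z.
have [u0 u0P] : exists u, forall n, lt (c n) u.
  have [|u uP] := @wo_countable_bounded (range c).
    exact: sub_countable (card_image_le _ _) _.
  by exists u => n; apply: uP; exists n.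
have [|m mP minm] := @wo_min [set u | forall n, lt (c n) u]; first by exists u0.
exists m; last exact: (mP 0).
have below p : lt p m -> exists n, w p (c n).
  move=> pm; apply: contrapT => np; apply: pm; apply: minm => n pc.
  by apply: np; exists n.
have cS n : w (c n) (c n.+1).
  exact: (wo_ltW (bP (c n) 0 (c n) (c n) (wo_refl _) (wo_refl _))).
have c_mono n k : w (c n) (c (k + n)).
  by elim: k => [|k IHk]; [exact: wo_refl | exact: wo_trans IHk (cS _)].
move=> i p q /below[n pn] /below[k qk].
apply: wo_lt_le (wo_ltW (mP (k + n).+1)); apply: (bP _ i.+1).
  exact: wo_trans pn (c_mono _ _).
by apply: wo_trans qk _; rewrite addnC; exact: c_mono.
Qed.

Lemma wo_closed_uncountable (F : nat -> T -> T -> T) : ~ countable (wo_closed F).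
Proof.
move=> /wo_countable_bounded[u uP]; have [m mcl um] := wo_closed_unbounded F u.
by apply: (uP m mcl); exact: wo_ltW.
Qed.

End WellOrder.

(** Otherwise each coordinate n has one value [k n] shared by all but countably many elements of
    [M]; then all but countably many elements equal the single real [k]. *)
Lemma uncountable_split (M : set (nat -> nat)) : ~ countable M ->
  exists n k, ~ countable (M `&` [set m | m n = k]) /\
              ~ countable (M `&` [set m | m n <> k]).
Proof.
move=> ncM; apply: contrapT => nsplit.
have /choice[k kP] n : exists k, countable (M `&` [set m | m n <> k]).
  (* If no k works, all fibres m(n) = k are countable, and they cover [M]. *)
  apply: contrapT => nk; apply: ncM.
  apply: (@countable_subset _ _ (\bigcup_k (M `&` [set m | m n = k]))).
    by move=> m Mm; exists (m n).
  apply: bigcup_countable => // k _; apply: contrapT => ck; apply: nsplit.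
  by exists n, k; split=> // cnk; apply: nk; exists k.
apply: ncM.
pose U (i : option nat) := if i is Some n then M `&` [set m | m n <> k n] else [set k].
apply: (@countable_subset _ _ (\bigcup_i U i)) => [m Mm|].
  have [mk|/existsNP[n mn]] := pselect (forall n, m n = k n); last by exists (Some n).
  by exists None => //=; apply/funext.
by apply: bigcup_countable => // -[n|] _; [exact: kP | exact: countable1].
Qed.

(** The codes of the pairs with sum t lie between two consecutive triangular numbers, so a code
    determines the sum first and then n. *)
Lemma cantor_pair_inj i n j m : cantor_pair i n = cantor_pair j m -> i = j /\ n = m.
Proof.
rewrite /cantor_pair.
have next t : 'C(t.+2, 2) = 'C(t.+1, 2) + t.+1 by rewrite binS bin1.
have tri_mono : {homo (fun t => 'C(t.+1, 2)) : s t / s <= t}.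
  by apply: homo_leq => // [s t u|s]; [exact: leq_trans | rewrite next leq_addr].
have lt_sum a b c d : a + b < c + d -> 'C((a + b).+1, 2) + b < 'C((c + d).+1, 2) + d.
  move=> /tri_mono /= le; rewrite next in le.
  apply: leq_trans (leq_addr _ _); apply: leq_trans le.
  by rewrite ltn_add2l ltnS leq_addl.
move=> E; have [lt|lt|sE] := ltngtP (i + n) (j + m).
- by have := lt_sum _ _ _ _ lt; rewrite E ltnn.
- by have := lt_sum _ _ _ _ lt; rewrite E ltnn.
have nm : n = m by move: E; rewrite sE => /addnI.
by split=> //; move: sE; rewrite nm => /addIn.
Qed.

Lemma unfold_real_onto (g : nat -> nat -> nat) : exists s, unfold_real s = g.
Proof.
pose P k (ij : nat * nat) := cantor_pair ij.1 ij.2 = k.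
exists (fun k => let ij := xget (0, 0) (P k) in g ij.1 ij.2).
apply/funext => i; apply/funext => n; rewrite /unfold_real.
case: xgetP => [[j m] _|/(_ (i, n))[]//].
by case/cantor_pair_inj => /= -> ->.
Qed.

(** * A Bernstein set *)

Section Bernstein.
Variables (w : rel (nat -> nat)) (H : (nat -> nat) -> (nat -> nat) -> nat -> nat).
Hypotheses (w_good : Sigma12_good w)
  (H_continuous : continuous (fun p : baire * baire => H p.1 p.2 : baire)).

Let lt x y := ~ w y x.
(** [lt] negates a Sigma^1_2 relation. This equivalent form is positive in [w], and distinctness of
    reals is witnessed by a number. *)
Let slt x y := w x y /\ exists n : nat, x n <> y n.

(* When [s] enumerates the initial segment below x, these say that {y | y < m},
   for m the [i]-th real of [s], is closed under [H], respectively is not.  Both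
   are positive in [w], and quantify over numbers only. *)
Definition formally_closed (s : nat -> nat) (i : nat) : Prop :=
  forall p q, w (unfold_real s i) (unfold_real s p) \/ (w (unfold_real s i) (unfold_real s q) \/
    slt (H (unfold_real s p) (unfold_real s q)) (unfold_real s i)).

Definition formally_unclosed (s : nat -> nat) (i : nat) : Prop :=
  exists p q,
    (slt (unfold_real s p) (unfold_real s i) /\ slt (unfold_real s q) (unfold_real s i)) /\
    w (unfold_real s i) (H (unfold_real s p) (unfold_real s q)).

(** The [i]-th real of [s] is the largest closed m: any real of [s] not below it is unclosed. *)
Definition bernstein (n k : nat) : set (nat -> nat) :=
  [set x | exists s, range (unfold_real s) = [set z | w z x] /\
    exists i, (unfold_real s i n = k /\ formally_closed s i) /\
      forall j, w (unfold_real s j) (unfold_real s i) \/ formally_unclosed s j].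

(** Apart from [s], the explicit quantifiers range over numbers; the clause on [range] is handled by
    [good_segments]. *)
Lemma bold_Sigma12_bernstein n k : bold_Sigma12 (bernstein n k : set baire).
Proof.
have w12 (T : topologicalType) (f g : T -> baire) : continuous f -> continuous g ->
    bold_Sigma12 [set x | w (f x) (g x)].
  exact: bold_Sigma12_Sigma12 (good_Sigma12 w_good).
have slt12 (T : topologicalType) (f g : T -> baire) : continuous f -> continuous g ->
    bold_Sigma12 [set x | slt (f x) (g x)].
  move=> cf cg; apply: bold_Sigma12_and; first exact: w12.
  apply: (bold_Sigma12_existsn (X := fun n => [set x | f x n <> g x n])) => m.
  have c : locconst (fun x => (f x m, g x m)).
    by apply: locconst_comp2; [exact: ((continuous_baire f).1 cf) |
      exact: ((continuous_baire g).1 cg)].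
  exact: (bold_Sigma12_locconst [set d | d.1 <> d.2] c).
have cu i : continuous (fun p : baire * baire => unfold_real p.2 i : baire).
  exact (comp_continuous (@continuous_snd _ _) (@continuous_reindex (fun m => cantor_pair i m))).
have cH p q : continuous (fun r : baire * baire =>
    H (unfold_real r.2 p) (unfold_real r.2 q) : baire).
  exact: (comp_continuous (continuous_pairing (cu p) (cu q)) H_continuous).
apply: (bold_Sigma12_exists (X := [set r : baire * baire |
  range (unfold_real r.2) = [set z | w z r.1] /\
    exists i, (unfold_real r.2 i n = k /\ formally_closed r.2 i) /\
      forall j, w (unfold_real r.2 j) (unfold_real r.2 i) \/ formally_unclosed r.2 j])).
apply: bold_Sigma12_and.
  exact: (bold_Sigma12_Sigma12 (good_segments w_good) (@continuous_snd _ _) (@continuous_fst _ _)).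
apply: bold_Sigma12_existsn => i; apply: bold_Sigma12_and.
  apply: bold_Sigma12_and.
    have c := (continuous_baire _).1 (cu i) n.
    exact: (bold_Sigma12_locconst [set d | d = k] c).
  apply: (robust_forall robust_Sigma12) => p; apply: (robust_forall robust_Sigma12) => q.
  by do 2?[apply: bold_Sigma12_or; first exact: w12]; exact: slt12.
apply: (robust_forall robust_Sigma12) => j; apply: bold_Sigma12_or; first exact: w12.
apply: bold_Sigma12_existsn => p; apply: bold_Sigma12_existsn => q.
by apply: bold_Sigma12_and; [apply: bold_Sigma12_and; exact: slt12 | exact: w12].
Qed.

Let hclosed m := forall p q, lt p m -> lt q m -> lt (H p q) m.

Let slt_lt x y : slt x y <-> lt x y.
Proof.
rewrite /lt (wo_lt (good_well_order w_good)); split=> -[xy nxy]; split=> //.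
  by move=> E; case: nxy => n; rewrite E.
apply: contrapT => /forallNP nn; apply: nxy; apply/funext => n.
exact: contrapT (nn n).
Qed.

Let w_refl := wo_refl (good_well_order w_good).
Let w_trans := @wo_trans _ _ (good_well_order w_good).
Let lt_w := @wo_ltW _ _ (good_well_order w_good).

(** A real y <= x has all its predecessors among the reals listed by [s], so the formal conditions
    on [s] express [hclosed] exactly. *)
Lemma bernsteinP n k x m : hclosed m -> w m x ->
    (forall m', hclosed m' -> w m' x -> w m' m) ->
  bernstein n k x <-> m n = k.
Proof.
move=> mcl mx mmax.
have seg s i : range (unfold_real s) = [set z | w z x] -> w (unfold_real s i) x.
  move=> sx; suff : [set z | w z x] (unfold_real s i) by [].
  by rewrite -sx; exists i.
have closedP s i : range (unfold_real s) = [set z | w z x] ->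
    formally_closed s i <-> hclosed (unfold_real s i).
  move=> sx; have six := seg s i sx.
  split=> [cl p q pi qi|cl p q].
    have onto y : lt y (unfold_real s i) -> range (unfold_real s) y.
      by move=> yi; rewrite sx /=; exact: w_trans (lt_w yi) six.
    have [p' _ pE] := onto p pi; have [q' _ qE] := onto q qi.
    by have := cl p' q'; rewrite pE qE => -[//|[//|/slt_lt]].
  have [|pi] := pselect (w (unfold_real s i) (unfold_real s p)); first by left.
  have [|qi] := pselect (w (unfold_real s i) (unfold_real s q)); first by right; left.
  by right; right; apply/slt_lt; exact: cl.
have unclosedP s j : formally_unclosed s j <-> ~ formally_closed s j.
  split=> [[p [q [[/slt_lt pj /slt_lt qj] jH]]] /(_ p q)[//|[//|/slt_lt]]|].
    by apply.
  move=> /existsNP[p /existsNP[q /not_orP[pj /not_orP[qj jH]]]]; exists p, q.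
  split; first by split; apply/slt_lt.
  by apply: contrapT => nw; apply: jH; apply/slt_lt.
split=> [[s [sx [i [[<- /(closedP _ _ sx) icl] imax]]]]|mnk].
  (* Both are the largest closed real below x: m by [mmax], the other by [imax]. *)
  suff -> : m = unfold_real s i by [].
  have six := seg s i sx.
  apply: (wo_anti (good_well_order w_good)) (mmax _ icl six).
  have [j _ mE] : range (unfold_real s) m by rewrite sx.
  by have := imax j; rewrite mE => -[//|/unclosedP[]]; apply/(closedP _ _ sx); rewrite mE.
have [g gx] := countable_range (good_countable w_good x) (w_refl x).
have [s sg] := unfold_real_onto g; exists s; rewrite sg; split=> //.
have sx : range (unfold_real s) = [set z | w z x] by rewrite sg.
have [i _ iE] : range (unfold_real s) m by rewrite sx.
rewrite -sg; exists i; rewrite iE; split.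
  by split=> //; apply/(closedP _ _ sx); rewrite iE.
move=> j; have [jcl|] := pselect (formally_closed s j); last by right; apply/unclosedP.
left; apply: mmax; first exact/(closedP _ _ sx).
exact: seg.
Qed.

Lemma exists_bernstein : exists X : set baire, bold_Sigma12 X /\
  forall z, injective (H z) -> (exists v, X (H z v)) /\ exists v, ~ X (H z v).
Proof.
have wo := good_well_order w_good; have cw := good_countable w_good.
(* The inverse of [H z] when that map is injective, with value zero off its range. *)
pose D z x := xget (fun=> 0) [set v | H z v = x].
pose F n := if n is 0 then H else D.
(* If [m] is closed under [F] and [z < m], then [m <= H z m], as
   [D z (H z m) = m]. *)
have [n [k [ck cnk]]] :=
  uncountable_split (wo_closed_uncountable wo cw baire_uncountable (F := F)).
exists (bernstein n k); split=> [|z injz]; first exact: bold_Sigma12_bernstein.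
have decide m : wo_closed w F m -> lt z m -> bernstein n k (H z m) <-> m n = k.
  move=> mcl zm; apply: bernsteinP => [p q||m' m'cl m'x].
  - exact: (mcl 0).
  - apply: contrapT => xm; have := mcl 1 z (H z m) zm xm; apply.
    rewrite /= /D; case: xgetP => [v _ /injz ->|/(_ m)[]//]; exact: w_refl.
  (* A closed m' > m has z and m below it, hence also H z m, and so is not below H z m. *)
  - apply: contrapT => mm'; apply: (m'cl z m) => //.
    by apply: (wo_le_lt wo) mm'; exact: lt_w.
have [m [mcl mk] zm] := wo_uncountable_above cw z ck.
have [m' [m'cl m'k] zm'] := wo_uncountable_above cw z cnk.
by split; [exists m; apply/decide | exists m' => /(decide m' m'cl zm')/m'k].
Qed.

End Bernstein.

(** * Perfect trees of outcomes *)

Lemma eq_mkseq_lt (D : Type) (f g : nat -> D) n :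
  (forall k, k < n -> f k = g k) -> mkseq f n = mkseq g n.
Proof.
by move=> fg; apply/eq_in_map => k; rewrite mem_iota add0n => /fg.
Qed.

Section Game.
Variables (R AR : choiceType).
Variables (le : R -> R -> Prop) (r : R -> nat -> AR) (lefin : AR -> AR -> Prop).
Hypothesis (hspace : wA2_space le r lefin).

Let le_refl A : le A A.
Proof. by case: (R_quasi_order hspace). Qed.

Lemma lhE A n : lh r (r A n) = n.
Proof.
rewrite /lh; case: xgetP => [m _ [B]|/(_ n)[]]; last by exists A.
by case/(A1_3 (space_A1 hspace)).
Qed.

Lemma approx_below_le A B n : le B A -> approx_below r lefin A (r B n).
Proof. by move/(wA2_2 (space_wA2 hspace)); apply. Qed.

Lemma approx_belowP A a : approx_below r lefin A a <-> exists d, depth r lefin A a = Some d.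
Proof.
rewrite /depth; case: pselect => [h|nh]; split=> //.
- by eexists.
- by move=> _; have [n /asboolP an] := h; exists n.
- by case=> n an; case: nh; exists n; apply/asboolP.
- by case.
Qed.

Lemma layer_next A D a n : le D A -> r D n = a -> layer r lefin (lh r a).+1 a A (r D n.+1).
Proof.
move=> DA <-; split; first exact: approx_below_le.
  by exists D, n, n.+1.
by rewrite !lhE.
Qed.

(** Choose [x n] with n-th approximation [c n]. By A1(3) it agrees with the chain up to n, so these
    points converge to [c], which lies in the closed set of all approximation sequences. *)
Lemma chain_limit (c : nat -> AR) :
  (forall n, lh r (c n) = n) -> (forall n, initial r (c n) (c n.+1)) ->
  exists C, forall n, r C n = c n.
Proof.
move=> lhc ic.
have /choice[x xc] n : exists A, r A n = c n.
  by have [A [m Am]] := AR_image hspace (c n); exists A; rewrite -[n in r A n]lhc -Am lhE.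
have xle k n : k <= n -> r (x n) k = c k.
  elim: n => [|n IHn]; first by rewrite leqn0 => /eqP ->.
  rewrite leq_eqVlt => /predU1P[-> //|kn].
  have [A [p [q [_ cn cn1]]]] := ic n.
  have pE : p = n by rewrite -(lhc n) cn lhE.
  have qE : q = n.+1 by rewrite -(lhc n.+1) cn1 lhE.
  rewrite {}pE {}qE in cn cn1.
  have rs B C m : r B m = r C m -> forall j, j < m -> r B j = r C j.
    by case/(A1_3 (space_A1 hspace)).
  rewrite (rs _ A n.+1) ?xc //.
  have [kn'|] := ltnP k n; last first.
    by move=> nk; rewrite (_ : k = n) ?cn //; apply/eqP; rewrite eqn_leq nk andbT.
  by rewrite -(rs (x n) A n) ?IHn ?xc // ltnW.
have xlim : (fun n => approx_seq r (x n)) @ \oo --> (c : {ptws nat -> discrete_topology AR}).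
  apply/cvg_sup => k U [V] [[W] oW <-] Wck WU.
  apply: (filterS WU); rewrite nbhs_simpl; exists k => // i /= ki.
  by rewrite /approx_seq xle.
have [|C _ Cc] := closed_cvg (range (approx_seq r)) (R_closed hspace) _ _ xlim.
  by apply: nearW => n; exists (x n).
by exists C => n; rewrite -Cc.
Qed.

Hypothesis (hdeep : deep le r lefin).

(** Deepness is applied with N larger than the depth of b in [A]. *)
Lemma deep_avoid A a b : (exists n, r A n = a) -> approx_below r lefin A b ->
  exists D, basic le r a A D /\ forall c, layer r lefin (lh r a).+1 a D c -> c <> b.
Proof.
move=> [n <-] /approx_belowP[d db].
have [D DA Dd] := hdeep d.+1 (approx_below_le n (le_refl A)).
by exists D; split=> // c /Dd + cb; rewrite cb db /= ltnn.
Qed.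

(* The branches of [phi] are outcomes, indexed by a perfect set. *)
Definition branching (phi : seq bool -> AR) (Y : set R) : Prop :=
  (forall u, phi (rcons u false) <> phi (rcons u true)) /\
  forall y : nat -> bool, exists2 C, Y C & forall n, r C n = phi (mkseq y n).

(** Each legal move of II lengthens the approximation by one, starting from length 0, so the
    positions form a chain with a limit. *)
Lemma legal_outcome (x : nat -> R) (s : nat -> AR * R) A : (s 0).1 = r A 0 ->
  (forall n, legalII le r lefin x s n) -> exists2 C, outcome r s C & forall n, r C n = (s n).1.
Proof.
move=> s0 legal.
have lhs n : lh r (s n).1 = n.
  elim: n => [|n IHn]; first by rewrite s0 lhE.
  by have [[_ _ ->] _] := legal n; rewrite IHn.
have [|C Cs] := chain_limit lhs.
  by move=> n; have [[]] := legal n.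
by exists C => // n; rewrite lhs.
Qed.

Lemma avoid_choice : exists avoid : R -> AR -> AR -> R, forall A a b,
  (exists n, r A n = a) -> approx_below r lefin A b ->
  basic le r a A (avoid A a b) /\
  forall c, layer r lefin (lh r a).+1 a (avoid A a b) c -> c <> b.
Proof.
have /choice[f fP] (t : R * AR * AR) : exists D, (exists n, r t.1.1 n = t.1.2) ->
    approx_below r lefin t.1.1 t.2 -> basic le r t.1.2 t.1.1 D /\
    forall c, layer r lefin (lh r t.1.2).+1 t.1.2 D c -> c <> t.2.
  have [[h1 h2]|nh] := pselect ((exists n, r t.1.1 n = t.1.2) /\ approx_below r lefin t.1.1 t.2).
    by have [D] := deep_avoid h1 h2; exists D.
  by exists t.1.1 => h1 h2; case: nh.
by exists (fun A a b => f (A, a, b)) => B a' b; exact: (fP (B, a', b)).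
Qed.

Variables (A : R) (Y : set R).
Let a := r A 0.

(** Bits choose the moves of II. Every bit sequence gives a legal run against [sigma], so its
    outcome is in [Y]. *)
Lemma I_ensures_branching : I_ensures le r lefin a A Y -> exists phi, branching phi Y.
Proof.
case=> sigma sigmaP; have [avoid avoidP] := avoid_choice.
(* Against the move X of I, II takes the next approximation of X, or of some
   [D <= X] whose next approximation is a different one. *)
pose mv (p : AR * R) X (b : bool) : AR * R :=
  let D := if b then avoid X p.1 (r X (lh r p.1).+1) else X in (r D (lh r p.1).+1, D).
pose hist := foldl (fun h b => rcons h (mv (last (a, A) h) (sigma h) b)) [::].
pose pos u := last (a, A) (hist u).
have histS u b : hist (rcons u b) = rcons (hist u) (mv (pos u) (sigma (hist u)) b).
  by rewrite /hist -cats1 foldl_cat.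
have posS u b : pos (rcons u b) = mv (pos u) (sigma (hist u)) b.
  by rewrite /pos histS last_rcons.
have legal (y : nat -> bool) : let s n := pos (mkseq y n) in
    let x n := sigma (hist (mkseq y n)) in
    (forall n, legalI le r x s n /\ legalII le r lefin x s n) /\
    (forall B, outcome r s B -> Y B).
  move=> s x.
  have xE n : x n = sigma (mkseq (fun k => s k.+1) n).
    congr sigma; elim: n => [//|n IHn].
    by rewrite [RHS]mkseqS -IHn [in LHS]mkseqS histS /s mkseqS posS.
  have [legI win] := sigmaP x s erefl xE.
  have legII n : legalI le r x s n -> legalII le r lefin x s n.
    case=> xle [k xk]; have lhk : lh r (s n).1 = k by rewrite -xk lhE.
    have [Dx Dk] : basic le r (s n).1 (x n) (s n.+1).2 /\ (s n.+1).1 = r (s n.+1).2 k.+1.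
      rewrite /s mkseqS posS /mv /= -/(s n) -/(x n) lhk; split=> //.
      case: (y n); last by split=> //; exists k.
      by apply: (avoidP _ _ _ _ _).1; [exists k | exact: approx_below_le].
    have [Dle [j Dj]] := Dx.
    have jk : j = k by rewrite -lhk -Dj lhE.
    rewrite jk in Dj; split; first by rewrite Dk; exact: layer_next.
    by split=> //; exists k.+1; rewrite Dk.
  have allII n : legalII le r lefin x s n.
    by elim/ltn_ind: n => n IHn; apply: legII; exact: legI.
  by split; [move=> n; split=> //; exact: legI | exact: win].
exists (fun u => (pos u).1); split=> [u|y].
  (* [u] is an initial part of its extension by [false]; legality of that run makes I's move at [u]
     legal. *)
  have [/(_ (size u))[[_ [k]]]] := legal (nth false u).
  rewrite mkseq_nth => pk _ _; rewrite !posS /=.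
  have lhk : lh r (pos u).1 = k by rewrite -pk lhE.
  rewrite lhk; set X := sigma (hist u) in pk *.
  have [||[Dle [j Dj]] Davoid] := avoidP X (pos u).1 (r X k.+1); first by exists k.
    exact: approx_below_le.
  apply/nesym/Davoid; have jk : j = k by rewrite -lhk -Dj lhE.
  by rewrite jk in Dj; exact: layer_next (le_refl _) Dj.
have [leg win] := legal y.
have [|C Co CE] := @legal_outcome _ _ A _ (fun n => (leg n).2); first by [].
by exists C; [exact: win | exact: CE].
Qed.

(** Bits now choose the moves of I. II controls the next approximation, so its answer to the
    repeated move is computed first, and the other move is chosen to avoid it. *)
Lemma II_ensures_branching : II_ensures le r lefin a A Y -> exists phi, branching phi Y.
Proof.
case=> tau tauP; have [avoid avoidP] := avoid_choice.
pose pos (h : seq R) := if h is [::] then (a, A) else tau h.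
(* I repeats the last move B of II, or plays some [D <= B] to which II cannot
   give the same answer as to B. *)
pose mv h (b : bool) :=
  if b then avoid (pos h).2 (pos h).1 (tau (rcons h (pos h).2)).1 else (pos h).2.
pose hist := foldl (fun h b => rcons h (mv h b)) [::].
have histS u b : hist (rcons u b) = rcons (hist u) (mv (hist u) b).
  by rewrite /hist -cats1 foldl_cat.
have posS h X : pos (rcons h X) = tau (rcons h X) by case: h.
pose s (y : nat -> bool) n := pos (hist (mkseq y n)).
pose x (y : nat -> bool) n := mv (hist (mkseq y n)) (y n).
have xE y n : mkseq (x y) n = hist (mkseq y n).
  by elim: n => [//|n IHn]; rewrite !mkseqS histS IHn.
have sE y n : s y n.+1 = tau (mkseq (x y) n.+1).
  by rewrite /s xE mkseqS histS posS.
have legII y n : (forall k, k <= n -> legalI le r (x y) (s y) k) ->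
    legalII le r lefin (x y) (s y) n.
  by have [+ _] := tauP (x y) (s y) erefl (sE y); apply.
have win y : (forall n, legalI le r (x y) (s y) n) -> forall B, outcome r (s y) B -> Y B.
  by have [_ +] := tauP (x y) (s y) erefl (sE y).
have stay y n : (forall k, k < n -> legalI le r (x y) (s y) k) ->
    exists k, r (s y n).2 k = (s y n).1.
  case: n => [|n] leg; first by exists 0.
  by have [_ [_ []]] := legII y n leg; eexists; eauto.
have response y n : (forall z k, k < n -> legalI le r (x z) (s z) k) ->
    layer r lefin (lh r (s y n).1).+1 (s y n).1 (s y n).2
      (tau (rcons (hist (mkseq y n)) (s y n).2)).1.
  (* II answers so in the run which agrees with y up to round n, where I repeats
     the last move of II. *)
  move=> leg; pose z k := (k < n) && y k.
  have zn : mkseq z n = mkseq y n by apply: eq_mkseq_lt => k kn; rewrite /z kn.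
  have sz : s z n = s y n by rewrite /s zn.
  have xz : x z n = (s y n).2 by rewrite /x /mv /z ltnn zn.
  have [|+ _] := legII z n.
    move=> k; rewrite leq_eqVlt => /predU1P[->|]; last exact: leg.
    by rewrite /legalI sz xz; split=> //; apply: stay; exact: leg.
  by rewrite sz xz sE mkseqS xE zn xz.
(* The induction treats all runs at once, since [response] needs legality in a run other than that
   of [y]. *)
have leg n : forall y, legalI le r (x y) (s y) n.
  elim/ltn_ind: n => n IHn y; rewrite /legalI /x /mv -/(s y n).
  have st : exists k, r (s y n).2 k = (s y n).1 by apply: stay => k kn; exact: IHn.
  case: (y n); last by split.
  apply: (avoidP _ _ _ _ _).1 => //.
  by have [] := response y n (fun z k kn => IHn k kn z).
exists (fun u => (pos (hist u)).1); split=> [u|y].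
  rewrite !histS !posS; pose y := nth false u.
  (* [y'] follows [u] and then takes the bit [true], which places II's answer in the layer governed
     by [avoid]. *)
  pose y' k := if k == size u then true else y k.
  have y'u : mkseq y' (size u) = u.
    rewrite -[RHS](mkseq_nth false); apply: eq_mkseq_lt => k.
    by rewrite /y' ltn_neqAle => /andP[/negPf ->].
  have [st bel] : (exists k, r (pos (hist u)).2 k = (pos (hist u)).1) /\
      approx_below r lefin (pos (hist u)).2 (tau (rcons (hist u) (pos (hist u)).2)).1.
    rewrite -y'u -/(s y' _); split; first by apply: stay => k _; exact: leg.
    by have [] := response y' (size u) (fun z k _ => leg k z).
  have [_ Davoid] := avoidP _ _ _ st bel.
  apply/nesym/Davoid.
  have [+ _] := legII y' (size u) (fun k _ => leg k y').
  by rewrite sE mkseqS xE /x /s /y' -/y' eqxx y'u /mv.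
have [|C Co CE] := @legal_outcome (x y) (s y) A _ (fun n => legII y n (fun k _ => leg k y)).
  by [].
by exists C; [apply: (win y) | exact: CE].
Qed.

End Game.

(** * Coding of trees *)

(* A code of the graph of [v]. *)
Definition bits (v : nat -> nat) (n : nat) : bool :=
  if unpickle n is Some (i, j) then v i == j else false.

Lemma bits_inj : injective bits.
Proof.
move=> v v' vv'; apply/funext => i; apply/esym/eqP.
have := congr1 (@^~ (pickle (i, v i))) vv'.
by rewrite /bits pickleK eqxx.
Qed.

(** [z] labels the nodes of the binary tree by numbers. Passing through [bits] lets [v] range over
    all reals. *)
Definition branch (z v : nat -> nat) (n : nat) : nat := z (pickle (mkseq (bits v) n)).

Lemma branch_continuous : continuous (fun p : baire * baire => branch p.1 p.2 : baire).
Proof.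
apply/continuous_baire => n.
apply: (locconst_bind (g := fun p : baire * baire => mkseq (bits p.2) n)
    (h := fun u (p : baire * baire) => p.1 (pickle u))) => [|u].
  apply: locconst_mkseq => k; rewrite /bits; case: unpickle => [[i j]|].
    apply: (locconst_comp (eq_op^~ j)).
    exact: (locconst_preim (@continuous_snd _ _) (@locconst_eval i)).
  exact: locconst_cst.
exact: (locconst_preim (@continuous_fst _ _) (@locconst_eval (pickle u))).
Qed.

(** Two equal branches that have followed the same bits so far must take the same next bit, as
    sibling labels differ. *)
Lemma branch_tree (phi : seq bool -> nat) :
    (forall u, phi (rcons u false) <> phi (rcons u true)) ->
  exists z, injective (branch z) /\ forall v n, branch z v n = phi (mkseq (bits v) n).
Proof.
move=> split_phi; pose z k := if unpickle k is Some u then phi u else 0; exists z.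
have zE v n : branch z v n = phi (mkseq (bits v) n) by rewrite /branch /z pickleK.
split=> // v v' vv'; apply: bits_inj.
suff mk n : mkseq (bits v) n = mkseq (bits v') n.
  by apply/funext => n; have := mk n.+1; rewrite !mkseqS => /rcons_inj[].
elim: n => [//|n IHn]; rewrite !mkseqS IHn; congr rcons.
have := congr1 (@^~ n.+1) vv'; rewrite /= !zE !mkseqS IHn.
by case: (bits v n) (bits v' n) => [] [] // E; case: (split_phi (mkseq (bits v') n)).
Qed.

Lemma approx_continuous (R AR : choiceType) (r : R -> nat -> AR) (e : AR -> nat) :
  continuous (fun A : space_topology r => (fun n => e (r A n)) : baire).
Proof.
apply/continuous_baire => n; apply: (locconst_comp e) => A.
have cr : continuous (approx_seq r : space_topology r -> _) by exact: initial_continuous.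
have /continuous_ptws /(_ n A [set b | b = r A n]) := cr.
by apply; rewrite nbhs_principalE; apply/principal_filterP.
Qed.

(** * The theorem *)

Theorem theorem4p8 (R AR : choiceType) (le : R -> R -> Prop)
    (r : R -> nat -> AR) (lefin : AR -> AR -> Prop)
    (hspace : wA2_space le r lefin)
    (hdeep : deep le r lefin)
    (hcount : countable [set: AR]%classic)
    (hgood : exists w : rel (nat -> nat), Sigma12_good w) :
  exists X : set R,
    bold_Sigma12 (X : set (space_topology r)) /\
    ~ kastanas_ramsey le r lefin X.
Proof.
have [w w_good] := hgood; have /countable_injP[e inje] := hcount.
have [X [X12 Xsplit]] := exists_bernstein w_good branch_continuous.
exists [set A | X (fun n => e (r A n))]; split.
  exact: (robust_preim robust_Sigma12 (@approx_continuous _ _ r e) X12).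
set Y := [set A | _].
(* Numbering approximations by [e] turns a perfect tree of outcomes into a real z, to which the
   Bernstein property applies. *)
have meets Z phi : branching r phi Z -> (exists2 C, Z C & Y C) /\ (exists2 C, Z C & ~ Y C).
  case=> split_phi Zphi; have [|z [injz zE]] := @branch_tree (e \o phi).
    by move=> u /inje; rewrite !in_setT => /(_ isT isT); exact: split_phi.
  have outcome v : exists2 C, Z C & (fun n => e (r C n)) = branch z v.
    by have [C ZC CE] := Zphi (bits v); exists C => //; apply/funext => n; rewrite zE CE.
  have [[v Xv] [v' Xv']] := Xsplit z injz.
  have [C ZC CE] := outcome v; have [C' ZC' CE'] := outcome v'.
  by split; [exists C => //; rewrite /Y /= CE | exists C' => //; rewrite /Y /= CE'].
have [A _] := R_nonempty hspace => /(_ A (r A 0)) [|B _].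
  by apply: (approx_below_le hspace); case: (R_quasi_order hspace).
(* All 0-th approximations coincide, so the game on [B] starts at [r B 0], as the branching lemmas
   require. *)
rewrite (A1_1 (space_A1 hspace) A B) => -[].
  move=> /(I_ensures_branching hspace hdeep)[phi /meets[[C nYC YC] _]]; exact: nYC.
by move=> /(II_ensures_branching hspace hdeep)[phi /meets[_ [C YC nYC]]].
Qed.
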